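(* Let $V$ be a real symmetric positive definite $p\times p$ matrix with eigenvalues $\lambda_1\ge\dots\ge\lambda_p>0$, let $\beta\in\mathbb{R}^p$, $k>0$ and $d\in\mathbb{R}$. Suppose that $-(k+d)(2\lambda_j+3k+d)>0$ for all $j=1,\dots,p$. Let $S_1=\operatorname{Cov}(\hat\beta_{\rm LTE})-\operatorname{Cov}(\hat\beta_{\rm AULTE})$, and let $b_{\rm LTE}$, $b_{\rm AULTE}$ denote the bias vectors of the two estimators. Then AULTE is superior to LTE in the matrix mean squared error sense, i.e. $\operatorname{MMSE}(\hat\beta_{\rm LTE})-\operatorname{MMSE}(\hat\beta_{\rm AULTE})$ is positive definite, if and only if $$b_{\rm AULTE}^\top\left(S_1+b_{\rm LTE}b_{\rm LTE}^\top\right)^{-1}b_{\rm AULTE}<1 .$$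
   Context: Setting: in the Bell regression model with full-column-rank design matrix $X$ and final weight matrix $\widehat W$, put $V=X^\top\widehat W X$ (symmetric positive definite). The maximum likelihood estimator $\hat\beta_{\rm MLE}$ of the coefficient vector $\beta\in\mathbb{R}^p$ is treated as having mean $\beta$ and covariance matrix $V^{-1}$, with $V$, $k$, $d$ regarded as fixed. Write $V_{k}=V+kI$ and $V_{d}=V-dI$. Liu-type estimator (LTE): $\hat\beta_{\rm LTE}=V_k^{-1}V_d\,\hat\beta_{\rm MLE}$, with $\operatorname{Cov}(\hat\beta_{\rm LTE})=V_k^{-1}V_dV^{-1}V_dV_k^{-1}$ and bias vector $b_{\rm LTE}=-(d+k)V_k^{-1}\beta$. Almost unbiased Liu-type estimator (AULTE): $\hat\beta_{\rm AULTE}=K\hat\beta_{\rm MLE}$ with $K=I-(k+d)^2V_k^{-2}$, with $\operatorname{Cov}(\hat\beta_{\rm AULTE})=KV^{-1}K^\top$ and bias vector $b_{\rm AULTE}=-(d+k)^2V_k^{-2}\beta$. For an estimator with covariance matrix $C$ and bias vector $b$, the matrix mean squared error is $\operatorname{MMSE}=C+bb^\top$. *)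

(* Defs.v *)
From HB Require Import structures.
From mathcomp Require Import all_boot all_order all_algebra.
From mathcomp Require Import all_classical all_reals all_analysis.

Set Implicit Arguments.
Unset Strict Implicit.
Unset Printing Implicit Defensive.

Import Order.TTheory GRing.Theory Num.Theory.

Local Open Scope ring_scope.

Definition posdefmx (R : realType) (p : nat) (A : 'M[R]_p) : Prop :=
  A^T = A /\ forall x : 'cV[R]_p, x != 0 -> 0 < (x^T *m A *m x) ord0 ord0.

(* The splitting of the characteristic polynomial makes [lam] list every
   eigenvalue with its algebraic multiplicity. *)
Definition decreasing_eigenvalues (R : realType) (p : nat) (A : 'M[R]_p)
    (lam : 'I_p -> R) : Prop :=
  char_poly A = \prod_(i < p) ('X - (lam i)%:P) /\
  forall i j : 'I_p, (i <= j)%N -> lam j <= lam i.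

Section random_vectors.
Variables (R : realType) (disp : measure_display) (T : measurableType disp).
Variables (P : probability T R) (p : nat).
Implicit Types X : T -> 'cV[R]_p.

Definition component X (i : 'I_p) : T -> R := fun w => X w i ord0.

Definition square_integrable X : Prop :=
  forall i : 'I_p, component X i \in Lfun P 2%:E.

(* [fine] loses nothing on square-integrable vectors, whose means and
   covariances are finite. *)
Definition mean X : 'cV[R]_p := \col_i fine ('E_P[component X i])%E.

Definition Cov X : 'M[R]_p :=
  \matrix_(i, j) fine (covariance P (component X i) (component X j)).

Definition bias X (beta : 'cV[R]_p) : 'cV[R]_p := mean X - beta.

Definition MMSE X (beta : 'cV[R]_p) : 'M[R]_p :=
  Cov X + bias X beta *m (bias X beta)^T.

End random_vectors.

Section estimators.
Variables (R : realType) (p : nat) (V : 'M[R]_p) (k d : R).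

Definition Vk : 'M[R]_p := V + k%:M.
Definition Vd : 'M[R]_p := V - d%:M.

Definition LTE_mx : 'M[R]_p := invmx Vk *m Vd.

Definition AULTE_mx : 'M[R]_p :=
  1%:M - (k + d) ^+ 2 *: (invmx Vk *m invmx Vk).

Definition LTE (T : Type) (bMLE : T -> 'cV[R]_p) : T -> 'cV[R]_p :=
  fun w => LTE_mx *m bMLE w.

Definition AULTE (T : Type) (bMLE : T -> 'cV[R]_p) : T -> 'cV[R]_p :=
  fun w => AULTE_mx *m bMLE w.

End estimators.

Section linear_images.
Variables (R : realType) (disp : measure_display) (T : measurableType disp).
Variables (P : probability T R) (p : nat).
Implicit Types (X : T -> 'cV[R]_p) (A : 'M[R]_p).

Let L21 (f : T -> R) : f \in Lfun P 2%:E -> f \in Lfun P 1.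
Proof. by apply: Lfun_subset12; rewrite fin_num_measure. Qed.

Let lin (X : T -> 'cV[R]_p) (a : 'I_p -> R) (s : seq 'I_p) : T -> R :=
  fun w => \sum_(j <- s) a j * component X j w.

Let coord_lin A X i : component (fun w => A *m X w) i = lin X (A i) (enum 'I_p).
Proof. by apply/funext => w; rewrite /component mxE /lin big_enum. Qed.

Let lin_cons X a j s : lin X a (j :: s) = (a j \o* component X j) \+ lin X a s.
Proof. by apply/funext => w /=; rewrite /lin big_cons mulrC. Qed.

Let lin_nil X a : lin X a [::] = cst 0.
Proof. by apply/funext => w /=; rewrite /lin big_nil. Qed.

Let scale_L2 X a j : square_integrable P X -> (a \o* component X j) \in Lfun P 2%:E.
Proof.
by move=> X2; rewrite Lfun_scale ?ler1n.
Qed.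

Let lin_L2 X a s : square_integrable P X -> lin X a s \in Lfun P 2%:E.
Proof.
move=> X2; elim: s => [|j s IH]; first by rewrite lin_nil Lfun_cst.
have S2 := scale_L2 (a j) j X2.
by rewrite lin_cons rpredD ?lee1n//= => _.
Qed.

Let mean_lin X a s : square_integrable P X ->
  ('E_P[lin X a s] = (\sum_(j <- s) a j * mean P X j ord0)%:E)%E.
Proof.
move=> X2; elim: s => [|j s IH].
  by rewrite lin_nil big_nil expectation_cst.
rewrite lin_cons expectationD ?L21 ?scale_L2 ?lin_L2// IH big_cons EFinD.
by rewrite expectationZl ?L21// EFinM mxE fineK// expectation_fin_num// L21.
Qed.

Let cov_lin X a s (Y : T -> R) : square_integrable P X -> Y \in Lfun P 2%:E ->
  (covariance P (lin X a s) Y =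
   (\sum_(j <- s) a j * fine (covariance P (component X j) Y))%:E)%E.
Proof.
move=> X2 Y2; elim: s => [|j s IH].
  by rewrite lin_nil big_nil covariance_cst_l.
rewrite lin_cons covarianceDl ?scale_L2 ?lin_L2// IH big_cons EFinD.
have XY := Lfun2_mul_Lfun1 (X2 j) Y2.
by rewrite (covarianceZl _ (L21 (X2 j)) (L21 Y2) XY) EFinM fineK// (covariance_fin_num (L21 (X2 j)) (L21 Y2) XY).
Qed.

Lemma mean_mulmx A X : square_integrable P X ->
  mean P (fun w => A *m X w) = A *m mean P X.
Proof.
move=> X2; apply/matrixP => i j; rewrite !mxE coord_lin mean_lin// big_enum /=.
by apply: eq_bigr => l _; rewrite (ord1 j) ?mxE.
Qed.

Lemma Cov_mulmx A X : square_integrable P X ->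
  Cov P (fun w => A *m X w) = A *m Cov P X *m A^T.
Proof.
move=> X2; apply/matrixP => i j.
rewrite !mxE !coord_lin cov_lin ?lin_L2// big_enum/=.
under eq_bigr => l _.
  rewrite covarianceC cov_lin//= big_enum /=.
  over.
under [RHS]eq_bigr => l _ do rewrite !mxE mulr_suml.
under eq_bigr => l _ do rewrite mulr_sumr.
rewrite exchange_big/=; apply: eq_bigr => m _; apply: eq_bigr => l _.
by rewrite mxE covarianceC mulrA mulrAC.
Qed.
End linear_images.

Section closed_forms.
Variables (R : realType) (disp : measure_display) (T : measurableType disp).
Variables (P : probability T R) (p : nat) (V : 'M[R]_p) (k d : R).
Variables (bMLE : T -> 'cV[R]_p) (beta : 'cV[R]_p).
Hypotheses (V_pd : posdefmx V) (k_gt0 : 0 < k).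
Hypotheses (bMLE_L2 : square_integrable P bMLE)
  (bMLE_mean : mean P bMLE = beta)
  (bMLE_Cov : Cov P bMLE = invmx V).

Lemma Vk_unit : Vk V k \in unitmx.
Proof.
case: V_pd => Vt Vp.
rewrite -row_free_unit -kermx_eq0; apply/eqP/row_matrixP => i.
rewrite row0; apply/eqP; apply: contraT => x0; set x := row i _ in x0.
have xV : x *m Vk V k = 0 by rewrite /x -row_mul mulmx_ker row0.
have := Vp x^T; rewrite trmx_eq0 => /(_ x0); rewrite trmxK.
have -> : x *m V = - (k *: x).
  by apply/eqP; rewrite -addr_eq0 -mul_mx_scalar -mulmxDr -/(Vk V k) xV.
rewrite mulNmx -scalemxAl 2!mxE oppr_gt0 pmulr_rlt0// mxE ltNge.
by rewrite sumr_ge0// => j _; rewrite [x^T _ _]mxE -expr2 sqr_ge0.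
Qed.

Lemma invVk_sym : (invmx (Vk V k))^T = invmx (Vk V k).
Proof. by case: V_pd => Vt _; rewrite trmx_inv /Vk linearD/= tr_scalar_mx Vt. Qed.

Lemma Cov_LTE : Cov P (LTE V k d bMLE) =
  invmx (Vk V k) *m Vd V d *m invmx V *m Vd V d *m invmx (Vk V k).
Proof.
case: V_pd => Vt _.
rewrite /LTE Cov_mulmx// bMLE_Cov /LTE_mx trmx_mul invVk_sym -!mulmxA.
by rewrite /Vd [in (_ - _)^T]linearB/= tr_scalar_mx Vt.
Qed.

Lemma bias_LTE : bias P (LTE V k d bMLE) beta =
  - (d + k) *: (invmx (Vk V k) *m beta).
Proof.
rewrite /bias /LTE mean_mulmx// bMLE_mean /LTE_mx.
have -> : Vd V d = Vk V k - (d + k)%:M.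
  by rewrite /Vd /Vk raddfD opprD addrACA subrr addr0.
rewrite mulmxBr mulVmx ?Vk_unit// mulmxBl mul1mx addrAC subrr add0r.
by rewrite mul_mx_scalar -scalemxAl scaleNr.
Qed.

Lemma Cov_AULTE : Cov P (AULTE V k d bMLE) =
  AULTE_mx V k d *m invmx V *m (AULTE_mx V k d)^T.
Proof. by rewrite /AULTE Cov_mulmx// bMLE_Cov. Qed.

Lemma bias_AULTE : bias P (AULTE V k d bMLE) beta =
  - (d + k) ^+ 2 *: (invmx (Vk V k) *m invmx (Vk V k) *m beta).
Proof.
rewrite /bias /AULTE mean_mulmx// bMLE_mean /AULTE_mx mulmxBl mul1mx addrAC subrr add0r.
by rewrite -scalemxAl scaleNr (addrC d).
Qed.
End closed_forms.

(* Main.v *)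
(* The hypothesis on [k], [d] and the eigenvalues forces [k + d < 0], hence
   [V - d I] is positive definite, and also [2 V + (3 k + d) I] is.  Since all
   the matrices involved commute, [S1] factors as a congruence
   [Z^T (-(k + d) V^-1 (2 V + (3 k + d) I)) Z] with [Z] invertible, so it is
   positive definite.  The claim is then Farebrother's criterion
   ([M - b b^T] is positive definite iff [b^T M^-1 b < 1]) applied to
   [M = S1 + b_LTE b_LTE^T]. *)
Require Import Defs.
From HB Require Import structures.
From mathcomp Require Import all_boot all_order all_algebra.
From mathcomp Require Import all_classical all_reals all_analysis.
From mathcomp Require Import sesquilinear spectral ring lra.
From mathcomp.real_closed Require Import complex.

Set Implicit Arguments.
Unset Strict Implicit.
Unset Printing Implicit Defensive.

Import Order.TTheory GRing.Theory Num.Theory.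

Local Open Scope ring_scope.

(** * Positive definiteness from the spectrum *)

(** Over [R[i]] the matrix is Hermitian, so a unitary [Q] diagonalizes it with real diagonal [D].
    The quadratic form at [x] becomes the sum of [D 0 i * |z i 0| ^ 2] with [z = Q x], which
    vanishes only for [x = 0]. *)
Lemma posdefmx_eigenvalue (R : realType) (p : nat) (A : 'M[R]_p) :
  A^T = A -> (forall a, eigenvalue A a -> 0 < a) -> posdefmx A.
Proof.
move=> At eig_gt0; split=> // x x0.
set f : {rmorphism R -> R[i]} := real_complex R.
pose AC := map_mx f A; pose xC := map_mx f x.
have fconj m n (M : 'M[R]_(m, n)) : map_mx Num.Def.conjC (map_mx f M) = map_mx f M.
  apply/matrixP => i j; rewrite !mxE conj_Creal//.
  by apply/complex_realP; exists (M i j).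
have ACherm : AC \is hermsymmx.
  by apply/is_hermitianmxP; rewrite expr0 scale1r /AC map_trmx At fconj.
have /hermitian_normalmx/orthomx_spectralP ACE := ACherm.
have Dreal := hermitian_spectral_diag_real ACherm.
set Q := spectralmx AC in ACE; set D := spectral_diag AC in ACE Dreal.
have Qu : Q \in unitmx by exact: spectral_unit.
have D_gt0 i : 0 < D 0 i.
  have /complex_realP[a Da] : D 0 i \is Num.real by exact: (mxOverP Dreal).
  (* Row [i] of [Q] is a left eigenvector of the complexified matrix for [D 0 i]. As this value is
     real, it is already an eigenvalue of [A] over [R]. *)
  rewrite Da ltcR eig_gt0// -(eigenvalue_map f).
  apply/eigenvalueP; exists (row i Q); last first.
    apply/eqP => /(congr1 (mulmx^~ (invmx Q)))/=.
    rewrite -row_mul mulmxV// mul0mx => /matrixP/(_ 0 i)/eqP.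
    by rewrite !mxE eqxx oner_eq0.
  rewrite -row_mul -/AC ACE !mulmxA mulmxV// mul1mx row_mul.
  by rewrite row_diag_mx -scalemxAl -rowE Da.
pose z := Q *m xC.
have z0 : z != 0.
  apply: contra_neq x0 => z0; apply/(map_mx_inj (f := f))/(can_inj (mulKmx Qu)).
  by rewrite -/xC -/z z0 map_mx0 mulmx0.
suff: 0 < real_complex R ((x^T *m A *m x) ord0 ord0) by rewrite ltcR.
have -> : real_complex R ((x^T *m A *m x) ord0 ord0) = \sum_i D 0 i * `|z i 0| ^+ 2.
  have -> : real_complex R ((x^T *m A *m x) ord0 ord0) = (xC^T *m AC *m xC) 0 0.
    by rewrite /xC /AC map_trmx -!map_mxM [RHS]mxE.
  have -> : xC^T *m AC *m xC = map_mx Num.Def.conjC z^T *m diag_mx D *m z.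
    rewrite ACE invmx_unitary ?spectral_unitarymx// /z trmx_mul map_mxM/=.
    by rewrite -map_trmx -map_trmx fconj !mulmxA.
  rewrite mxE; apply: eq_bigr => i _.
  by rewrite mul_mx_diag !mxE normCKC mulrAC mulrC mulrA.
have term_ge0 i : true -> 0 <= D 0 i * `|z i 0| ^+ 2.
  by rewrite mulr_ge0 ?exprn_ge0// ltW.
rewrite lt_neqAle sumr_ge0// andbT eq_sym.
apply: contra_neq z0 => /(psumr_eq0P term_ge0) z0.
apply/matrixP => i j; rewrite (ord1 j) [RHS]mxE; apply/eqP.
by have /eqP := z0 i isT; rewrite mulf_eq0 gt_eqF//= sqrf_eq0 normr_eq0.
Qed.

(** * Positive definite matrices and rank-one perturbations *)

Section posdef_theory.
Variables (R : realType) (p : nat).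
Implicit Types (A B Z : 'M[R]_p) (b x y : 'cV[R]_p).

Lemma posdefmx_sym A : posdefmx A -> A^T = A.
Proof. by case. Qed.

Lemma posdefmx_gt0 A x : posdefmx A -> x != 0 -> 0 < (x^T *m A *m x) ord0 ord0.
Proof. by case=> _; exact. Qed.

Lemma posdefmx_ge0 A x : posdefmx A -> 0 <= (x^T *m A *m x) ord0 ord0.
Proof.
move=> Apd; have [->|x0] := eqVneq x 0; first by rewrite mulmx0 mxE.
exact/ltW/posdefmx_gt0.
Qed.

Lemma posdefmx_unit A : posdefmx A -> A \in unitmx.
Proof.
move=> Apd; rewrite -row_free_unit -kermx_eq0.
apply/eqP/row_matrixP => i; rewrite row0; apply/eqP; apply: contraT => x0.
have := posdefmx_gt0 (x := (row i (kermx A))^T) Apd.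
rewrite trmx_eq0 trmxK -row_mul mulmx_ker row0 mul0mx mxE ltxx.
by move=> /(_ x0).
Qed.

Lemma posdefmxZ a A : 0 < a -> posdefmx A -> posdefmx (a *: A).
Proof.
move=> a0 Apd; split=> [|x x0]; first by rewrite linearZ/= (posdefmx_sym Apd).
by rewrite -scalemxAr -scalemxAl mxE mulr_gt0// posdefmx_gt0.
Qed.

Lemma posdefmx_congr A Z : Z \in unitmx -> posdefmx A -> posdefmx (Z^T *m A *m Z).
Proof.
move=> Zu Apd; split=> [|x x0].
  by rewrite !trmx_mul trmxK (posdefmx_sym Apd) mulmxA.
rewrite !mulmxA -trmx_mul -mulmxA posdefmx_gt0//.
by apply: contra_neq x0 => Zx0; rewrite -(mulKmx Zu x) Zx0 mulmx0.
Qed.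

Lemma posdefmx_inv A : posdefmx A -> posdefmx (invmx A).
Proof.
move=> Apd; have Au := posdefmx_unit Apd; have At := posdefmx_sym Apd.
have : posdefmx ((invmx A)^T *m A *m invmx A).
  by apply: posdefmx_congr; rewrite ?unitmx_inv.
by rewrite trmx_inv At mulVmx// mul1mx.
Qed.

Lemma quad_rank1 b x :
  (x^T *m (b *m b^T) *m x) ord0 ord0 = (x^T *m b) ord0 ord0 ^+ 2.
Proof.
rewrite mulmxA -mulmxA mxE big_ord1 expr2; congr (_ * _).
by rewrite -[b^T *m x]trmxK trmx_mul trmxK mxE.
Qed.

Lemma posdefmx_add_rank1 A b : posdefmx A -> posdefmx (A + b *m b^T).
Proof.
move=> Apd; split=> [|x x0].
  by rewrite linearD/= trmx_mul trmxK (posdefmx_sym Apd).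
by rewrite mulmxDr mulmxDl mxE quad_rank1 ltr_wpDr ?sqr_ge0// posdefmx_gt0.
Qed.

Lemma posdefmx_cauchy_schwarz A x y : posdefmx A ->
  (x^T *m A *m y) ord0 ord0 ^+ 2 <=
  (x^T *m A *m x) ord0 ord0 * (y^T *m A *m y) ord0 ord0.
Proof.
move=> Apd; have [->|y0] := eqVneq y 0.
  by rewrite !mulmx0 mxE expr0n mulr0.
have s0 := posdefmx_gt0 Apd y0.
set s := (y^T *m A *m y) ord0 ord0 in s0 *; set t := (x^T *m A *m y) ord0 ord0.
have yAx : (y^T *m A *m x) ord0 ord0 = t.
  transitivity ((x^T *m A *m y)^T ord0 ord0); last by rewrite mxE.
  by rewrite !trmx_mul trmxK (posdefmx_sym Apd) mulmxA.
have subE (M N : 'M[R]_1) : (M - N) ord0 ord0 = M ord0 ord0 - N ord0 ord0.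
  by rewrite mxE [X in _ + X]mxE.
have scaleE a (M : 'M[R]_1) : (a *: M) ord0 ord0 = a * M ord0 ord0 by rewrite mxE.
(* Up to the factor [s], this vector is the [A]-orthogonal projection of [x] off [y]; scaling by [s]
   avoids division. The form there equals [s] times the wanted difference. *)
have := posdefmx_ge0 (s *: x - t *: y) Apd.
have -> : (s *: x - t *: y)^T = s *: x^T - t *: y^T.
  by rewrite linearB/= !linearZ.
rewrite !mulmxBl !mulmxBr.
rewrite -!scalemxAl -!scalemxAr !subE !scaleE yAx -/t -/s => H.
have {H} : 0 <= s * ((x^T *m A *m x) ord0 ord0 * s - t ^+ 2).
  by apply: le_trans H _; rewrite le_eqVlt; apply/orP; left; apply/eqP; ring.
by rewrite pmulr_rge0// subr_ge0.
Qed.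

(* Eigenvalues of the product are positive although it need not be positive
   definite a priori: [v (A B) = a v] gives [v A v^T = a (v B^-1 v^T)]. *)
Lemma posdefmxM A B : posdefmx A -> posdefmx B -> A *m B = B *m A ->
  posdefmx (A *m B).
Proof.
move=> Apd Bpd AB; have Bu := posdefmx_unit Bpd.
apply: posdefmx_eigenvalue => [|a /eigenvalueP[v vAB v0]].
  by rewrite trmx_mul (posdefmx_sym Apd) (posdefmx_sym Bpd).
have vt0 : v^T != 0 by rewrite trmx_eq0.
have Bv := posdefmx_gt0 (posdefmx_inv Bpd) vt0; rewrite trmxK in Bv.
have := posdefmx_gt0 Apd vt0.
rewrite trmxK -(mulmxK Bu (v *m A)) -(mulmxA v A B) vAB -!scalemxAl mxE.
by rewrite pmulr_lgt0.
Qed.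

(** With [y = A^-1 b] and [s = b^T A^-1 b], the perturbed form at [y] is [s - s^2], which forces
    [s < 1]. Conversely, Cauchy-Schwarz for [x] and [y] bounds [(x^T b)^2] by [s * (x^T A x)]. *)
Lemma posdefmx_sub_rank1 A b : posdefmx A ->
  posdefmx (A - b *m b^T) <-> (b^T *m invmx A *m b) ord0 ord0 < 1.
Proof.
move=> Apd; have Au := posdefmx_unit Apd; have At := posdefmx_sym Apd.
have [->|b0] := eqVneq b 0.
  by rewrite trmx0 !mul0mx subr0 mxE ltr01.
pose y := invmx A *m b.
have Ay : A *m y = b by rewrite mulKVmx.
have y0 : y != 0 by apply: contra_neq b0 => y0; rewrite -Ay y0 mulmx0.
have yt : y^T *m b = b^T *m invmx A *m b by rewrite trmx_mul trmx_inv At.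
have s0 := posdefmx_gt0 Apd y0; rewrite -mulmxA Ay yt in s0.
have quadB x : (x^T *m (A - b *m b^T) *m x) ord0 ord0 =
    (x^T *m A *m x) ord0 ord0 - (x^T *m b) ord0 ord0 ^+ 2.
  by rewrite mulmxBr mulmxBl -quad_rank1 mxE [X in _ + X]mxE.
split=> [Mpd|s1].
  have := posdefmx_gt0 Mpd y0; rewrite quadB -mulmxA Ay yt expr2 subr_gt0.
  by rewrite gtr_pMr.
split=> [|x x0]; first by rewrite linearB/= At trmx_mul trmxK.
rewrite quadB subr_gt0.
have := posdefmx_cauchy_schwarz x y Apd.
rewrite -!mulmxA Ay yt mulmxA => /le_lt_trans; apply.
by rewrite gtr_pMr// posdefmx_gt0.
Qed.

End posdef_theory.

(** * Factorization of the covariance difference *)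

(** Reduces identities between products of shifts of [V] to ring identities between scalar
    coefficients. *)
Lemma mulmx_addscalar (R : comNzRingType) (p : nat) (V : 'M[R]_p) (a b : R) :
  (V + a%:M) *m (V + b%:M) = V *m V + (a + b) *: V + (a * b)%:M.
Proof.
rewrite mulmxDl !mulmxDr mul_mx_scalar mul_scalar_mx -scalar_mxM.
by rewrite scalerDl [a *: V + b *: V]addrC !addrA.
Qed.

Section covariance_difference.
Variables (R : realType) (p : nat) (V : 'M[R]_p) (k d : R).
Hypotheses (V_pd : posdefmx V) (k_gt0 : 0 < k).

Let c := k + d.
Let W := invmx (Vk V k).
Let N := V + (2 * k + d)%:M.
Let B := 2 *: V + (3 * k + d)%:M.

(** A difference of squares: [Vd] and [N] are [Vk] shifted by [-c] and [+c]. *)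
Lemma AULTE_mxE : AULTE_mx V k d = W *m Vd V d *m N *m W.
Proof.
have Wu := Vk_unit V_pd k_gt0.
have VdN : Vd V d *m N = Vk V k *m Vk V k - (c ^+ 2)%:M.
  rewrite /Vd -raddfN /Vk /N !mulmx_addscalar -[in RHS]addrA -raddfB.
  by congr (_ + _ *: _ + _%:M); rewrite /c; ring.
rewrite -(mulmxA W) VdN mulmxBr mulmxBl mul_mx_scalar -scalemxAl !mulmxA.
by rewrite mulVmx// mul1mx mulmxV.
Qed.

(* In terms of an eigenvalue [l] of [V] this is
   (l - d)^2/(l (l+k)^2) - (l - d)^2 (l+2k+d)^2/(l (l+k)^4)
   = -(k+d) (2l+3k+d) (l-d)^2 / (l (l+k)^4). *)
Lemma Cov_diffE :
  W *m Vd V d *m invmx V *m Vd V d *m W -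
    AULTE_mx V k d *m invmx V *m (AULTE_mx V k d)^T =
  (W *m Vd V d *m W)^T *m (- c *: (invmx V *m B)) *m (W *m Vd V d *m W).
Proof.
have Vu := posdefmx_unit V_pd; have Vt := posdefmx_sym V_pd.
have Wu := Vk_unit V_pd k_gt0.
have Wt : W^T = W by exact: invVk_sym.
have Vdt : (Vd V d)^T = Vd V d by rewrite /Vd linearB/= tr_scalar_mx Vt.
have Nt : N^T = N by rewrite /N linearD/= tr_scalar_mx Vt.
have VkN : Vk V k *m N = N *m Vk V k.
  by rewrite /Vk /N !mulmx_addscalar; congr (_ + _ *: _ + _%:M); ring.
have WN : W *m N = N *m W.
  by rewrite -[N in LHS](mulmxK Wu) -/W -VkN !mulmxA mulVmx// mul1mx.
(* Expanding both products, the [V] terms cancel. The remaining coefficients are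
   [2 (k - (2k+d)) = -2c] for the identity and [k^2 - (2k+d)^2 = -c (3k+d)] for [V^-1]. *)
have inner : Vk V k *m invmx V *m Vk V k - N *m invmx V *m N =
    - c *: (invmx V *m B).
  have sandwich a : (V + a%:M) *m invmx V *m (V + a%:M) =
      V + (2 * a) *: 1%:M + a ^+ 2 *: invmx V.
    rewrite mulmxDl mulmxV// mul_scalar_mx mulmxDl mul1mx mulmxDr -!scalemxAl.
    rewrite mulVmx// mul_mx_scalar scalerA -expr2 !addrA -[a%:M]scalemx1.
    by rewrite -(addrA V) -scalerDl mulr2n mulrDl mul1r.
  rewrite /Vk /N !sandwich /B mulmxDr -scalemxAr mulVmx// mul_mx_scalar.
  apply/matrixP => i j; rewrite !mxE /c; ring.
rewrite AULTE_mxE -inner; move: (Vd V d) Vdt => U Ut.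
rewrite !trmx_mul Wt Ut Nt mulmxBr mulmxBl !mulmxA; congr (_ - _).
  by rewrite /W (mulmxKV Wu) (mulmxK Wu).
by rewrite -!(mulmxA _ W N) WN !mulmxA.
Qed.

Lemma posdefmx_Cov_diff : c < 0 -> posdefmx B ->
  posdefmx (W *m Vd V d *m invmx V *m Vd V d *m W -
    AULTE_mx V k d *m invmx V *m (AULTE_mx V k d)^T).
Proof.
move=> c_lt0 B_pd; have Vu := posdefmx_unit V_pd.
have Nd_gt0 : 0 < - d by move: c_lt0; rewrite /c; move: k_gt0; lra.
(* Since [-d] is positive, invertibility of [Vd] is an instance of that of [Vk]. *)
have VdE : Vd V d = Vk V (- d) by rewrite /Vk raddfN.
have Vd_unit : Vd V d \in unitmx by rewrite VdE (Vk_unit V_pd Nd_gt0).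
have W_unit : W \in unitmx by rewrite unitmx_inv (Vk_unit V_pd k_gt0).
rewrite Cov_diffE; apply: posdefmx_congr; first by rewrite !unitmx_mul W_unit Vd_unit.
apply: posdefmxZ; first by rewrite oppr_gt0.
apply: posdefmxM => //; first exact: posdefmx_inv.
rewrite /B mulmxDr mulmxDl -scalemxAr -scalemxAl mulVmx// mulmxV//.
by rewrite mul_mx_scalar mul_scalar_mx.
Qed.

End covariance_difference.

(** * From the eigenvalue condition to the criterion *)

Lemma root_char_poly_eigenvalues (R : realType) (p : nat) (A : 'M[R]_p)
    (lam : 'I_p -> R) (a : R) :
  decreasing_eigenvalues A lam -> eigenvalue A a -> exists j, a = lam j.
Proof.
case=> charE _; rewrite eigenvalue_root_char charE rootE horner_prod.
move=> /eqP/eqP; rewrite prodf_seq_eq0 => /hasP[j _] /=.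
by rewrite hornerXsubC subr_eq0 => /eqP ->; exists j.
Qed.

(** An eigenvalue [e] of the affine image comes from the eigenvalue [(e - b) / a] of [A], which is
    some [lam j]. *)
Lemma posdefmx_affine (R : realType) (p : nat) (A : 'M[R]_p) (lam : 'I_p -> R)
    (a b : R) : A^T = A -> decreasing_eigenvalues A lam -> 0 < a ->
  (forall j, 0 < a * lam j + b) -> posdefmx (a *: A + b%:M).
Proof.
move=> At Alam a0 aff_gt0; apply: posdefmx_eigenvalue => [|e].
  by rewrite linearD/= linearZ/= At tr_scalar_mx.
case/eigenvalueP=> v + v0; rewrite mulmxDr -scalemxAr mul_mx_scalar => ve.
have /(root_char_poly_eigenvalues Alam)[j ej] : eigenvalue A ((e - b) / a).
  apply/eigenvalueP; exists v => //.
  apply: (scalerI (lt0r_neq0 a0)).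
  by rewrite scalerA mulrC divfK ?gt_eqF// scalerBl -ve addrK.
by have := aff_gt0 j; rewrite -ej mulrC divfK ?gt_eqF// subrK.
Qed.

Theorem theorem5 (R : realType) (p : nat) (V : 'M[R]_p) (lam : 'I_p -> R)
    (beta : 'cV[R]_p) (k d : R)
    (disp : measure_display) (T : measurableType disp) (P : probability T R)
    (bMLE : T -> 'cV[R]_p)
    (V_posdef : posdefmx V)
    (V_eigen : decreasing_eigenvalues V lam)
    (lam_gt0 : forall j : 'I_p, 0 < lam j)
    (k_gt0 : 0 < k)
    (bMLE_L2 : square_integrable P bMLE)
    (bMLE_mean : mean P bMLE = beta)
    (bMLE_Cov : Cov P bMLE = invmx V)
    (hkd : forall j : 'I_p, 0 < - (k + d) * (2 * lam j + 3 * k + d)) :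
  let bLTE := LTE V k d bMLE in
  let bAULTE := AULTE V k d bMLE in
  let S1 := Cov P bLTE - Cov P bAULTE in
  let b_LTE := bias P bLTE beta in
  let b_AULTE := bias P bAULTE beta in
  posdefmx (MMSE P bLTE beta - MMSE P bAULTE beta) <->
  (b_AULTE^T *m invmx (S1 + b_LTE *m b_LTE^T) *m b_AULTE) ord0 ord0 < 1.
Proof.
move=> bLTE bAULTE S1 b_LTE b_AULTE.
have S1_pd : posdefmx S1.
  rewrite /S1 /bLTE /bAULTE.
  rewrite (Cov_LTE _ _ V_posdef)// Cov_AULTE//.
  (* In dimension 0 the eigenvalue condition is vacuous and gives no sign for [k + d], but there is
     no nonzero vector to test. *)
  have [p0|p_gt0] := posnP p.
    split=> [|x /eqP[]]; apply/matrixP => i; by have := ltn_ord i; rewrite {2}p0.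
  pose j0 := Ordinal p_gt0.
  (* If [k + d >= 0], then [2 lam + 3k + d = 2 lam + 2k + (k + d)] is also nonnegative, against
     [hkd]. *)
  have kd_lt0 : k + d < 0.
    rewrite ltNge; apply/negP => kd_ge0.
    have := hkd j0; rewrite ltNge mulNr oppr_le0 mulr_ge0//.
    by move: (lam_gt0 j0) k_gt0 kd_ge0; lra.
  apply: posdefmx_Cov_diff => //.
  apply: (posdefmx_affine (posdefmx_sym V_posdef) V_eigen) => // j.
  by rewrite addrA -(@pmulr_rgt0 _ (- (k + d))) ?oppr_gt0.
have -> : MMSE P bLTE beta - MMSE P bAULTE beta =
    S1 + b_LTE *m b_LTE^T - b_AULTE *m b_AULTE^T.
  by rewrite /MMSE /S1 opprD addrACA addrA.
exact/posdefmx_sub_rank1/posdefmx_add_rank1.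
Qed.
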